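(* Let $G$ be a weakly distance-regular graph with at least six vertices and parameters $(k,\lambda,\mu')$ with $\mu'\ge 2$. Then $G$ is $2$-reconstructible; that is, if $G$ has $n$ vertices, then every $n$-vertex graph having the same $(n-2)$-deck as $G$ is isomorphic to $G$.
   Context: All graphs are finite, simple (no loops or multiple edges). For an $n$-vertex graph $G$ and $1\le k\le n$, the $k$-deck of $G$ is the multiset of isomorphism classes of the $\binom{n}{k}$ induced subgraphs of $G$ on $k$ vertices (one for each $k$-subset of $V(G)$). A graph is $\ell$-reconstructible if it is determined up to isomorphism by its $(n-\ell)$-deck. A graph is weakly distance-regular with parameters $(k,\lambda,\mu')$ if it is $k$-regular, any two adjacent vertices have exactly $\lambda$ common neighbors, and any two vertices at distance exactly $2$ have exactly $\mu'$ common neighbors. *)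

(* Defs.v *)
From HB Require Import structures.
From mathcomp Require Import all_boot.

Set Implicit Arguments.
Unset Strict Implicit.
Unset Printing Implicit Defensive.

Record sgraph := SGraph {
  vertex :> finType;
  adj : rel vertex;
  adj_sym : symmetric adj;
  adj_irrefl : irreflexive adj }.

Definition giso (G H : sgraph) : Prop :=
  exists f : G -> H, bijective f /\ {mono f : x y / adj x y}.

(* Boolean version of [giso], needed to count induced subgraphs; see [gisobP]. *)
Definition gisob (G H : sgraph) : bool :=
  (#|G| == #|H|) &&
  [exists f : {ffun G -> H},
     injectiveb f && [forall x, forall y, adj (f x) (f y) == adj x y]].

Lemma gisobP (G H : sgraph) : reflect (giso G H) (gisob G H).
Proof.
apply: (iffP andP) => [[/eqP cGH /existsP[f /andP[/injectiveP f_inj /forallP fP]]]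
                      |[f [f_bij f_mono]]].
  exists f; split; first by apply: inj_card_bij => //; rewrite cGH.
  by move=> x y; apply/eqP/(forallP (fP x)).
split; first by apply/eqP/(bij_eq_card f_bij).
apply/existsP; exists (finfun f); apply/andP; split.
  by apply/injectiveP => x y; rewrite !ffunE; apply: bij_inj.
by apply/forallP => x; apply/forallP => y; rewrite !ffunE f_mono.
Qed.

Section Induced.
Variables (G : sgraph) (S : {set G}).

Definition induced_adj : rel {x : G | x \in S} := fun x y => adj (val x) (val y).

Lemma induced_adj_sym : symmetric induced_adj.
Proof. by move=> x y; apply: adj_sym. Qed.

Lemma induced_adj_irrefl : irreflexive induced_adj.
Proof. by move=> x; apply: adj_irrefl. Qed.

Definition induced : sgraph := SGraph induced_adj_sym induced_adj_irrefl.

End Induced.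

(* A multiset of isomorphism classes is given by its multiplicity function:
   [deck G k H] is the multiplicity of the class of [H] in the [k]-deck of [G]. *)
Definition deck (G : sgraph) (k : nat) (H : sgraph) : nat :=
  #|[set S : {set G} | (#|S| == k) && gisob (induced S) H]|.

Definition same_deck (k : nat) (G H : sgraph) : Prop := deck G k =1 deck H k.

(* Intended for [l < #|G|], since the subtraction is truncated. *)
Definition reconstructible (l : nat) (G : sgraph) : Prop :=
  forall H : sgraph, #|H| = #|G| -> same_deck (#|G| - l) G H -> giso H G.

Definition walk (G : sgraph) (x y : G) (d : nat) : Prop :=
  exists p : seq G, [/\ path (@adj G) x p, last x p = y & size p = d].

Definition at_distance (G : sgraph) (d : nat) (x y : G) : Prop :=
  walk x y d /\ forall d', walk x y d' -> d <= d'.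

Definition common_nbrs (G : sgraph) (x y : G) : {set G} :=
  [set z | adj x z && adj y z].

Definition weakly_distance_regular (G : sgraph) (k lambda mu' : nat) : Prop :=
  [/\ forall x : G, #|[set y | adj x y]| = k,
      forall x y : G, adj x y -> #|common_nbrs x y| = lambda
    & forall x y : G, at_distance 2 x y -> #|common_nbrs x y| = mu'].

(* Main.v *)
Require Import Defs.
From mathcomp Require Import all_boot.
From mathcomp Require Import zify.

Set Implicit Arguments.
Unset Strict Implicit.
Unset Printing Implicit Defensive.

(** Let [H] have the same [(n-2)]-deck as [G], and let the codegree of two
vertices be their number of common neighbours (so that the codegree of a vertex
with itself is its degree).  By Kelly's counting argument the sums of
[binomial (codegree) i] over the diagonal, the edges and the non-edges are
determined by the deck as long as the configurations counted have at most [n-2]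
vertices.  The sum of [(c - k)^2] over the diagonal therefore vanishes for [H],
so that [H] is [k]-regular; likewise all codegrees on edges are [lambda].  Over
the non-edges the sum of [c (c - mu')^2] vanishes, so that [c] is [0] or [mu'].
This last step needs five vertices in a card; for [n = 6] a count of the paths
of length two leaving a vertex shows that [mu' = k] unless all these codegrees
are [0], so that [c (mu' - c)] is nonnegative, and its sum vanishes.

Now match a card [H - {u, v}] with a card [G - {x, y}].  The degrees in the card
tell which vertices have lost two, one or no neighbours.  Two vertices that lost
one neighbour each lost the same one iff their codegree in the card is [lambda - 1]
(if adjacent) or [mu' - 1] (if not), and [mu' - 1] is neither [0] nor [mu'].
Hence the isomorphism of cards extends, possibly after exchanging [x] and [y]. *)

(** * Isomorphism-invariant sums over a deck *)

(** The hypotheses make [r] an equivalence, so [s] and [t] represent the same multiset of classes: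
    the head of [s] can be cancelled against a related element of [t]. *)
Lemma eq_sum_of_eq_count (T : Type) (r : rel T) (f : T -> nat) (s t : seq T) :
    reflexive r -> (forall a b, r a b -> r a =1 r b) ->
    (forall a b, r a b -> f a = f b) ->
    (forall c, count (r^~ c) s = count (r^~ c) t) ->
  \sum_(a <- s) f a = \sum_(a <- t) f a.
Proof.
move=> rxx r_eq f_eq; elim: s t => [|a s IHs] t est.
  case: t est => [|b t] // /(_ b); rewrite /= rxx; lia.
have [t1 [b [t2 [Et rba]]]] : exists t1 b t2, t = t1 ++ b :: t2 /\ r b a.
  have : 0 < count (r^~ a) t by rewrite -est /= rxx.
  elim: t {est} => // b t IHt /=; case: (boolP (r b a)) => [rba _|_ /= /IHt].
    by exists [::], b, t.
  by case=> t1 [c [t2 [-> rca]]]; exists (b :: t1), c, t2.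
rewrite big_cons {t}Et big_cat big_cons /= in est *.
rewrite (IHs (t1 ++ t2)) ?big_cat /= ?(f_eq _ _ rba) 1?addnCA // => c.
by move: (est c); rewrite !count_cat /= (r_eq _ _ rba); lia.
Qed.

Lemma gisob_refl : reflexive gisob.
Proof. by move=> K; apply/gisobP; exists id; split=> //; exists id. Qed.

Lemma gisob_eq (K L : sgraph) : gisob K L -> gisob K =1 gisob L.
Proof.
move=> /gisobP[f [f_bij f_mono]] M; have [g fK gK] := f_bij.
apply/gisobP/gisobP => -[h [h_bij h_mono]].
  exists (h \o g); split; first by apply: bij_comp => //; exists f.
  by move=> x y /=; rewrite h_mono -f_mono !gK.
exists (h \o f); split; first exact: bij_comp.
by move=> x y /=; rewrite h_mono f_mono.
Qed.

Lemma same_deck_sum (G H : sgraph) (m : nat) (f : sgraph -> nat) :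
    (forall K L, giso K L -> f K = f L) -> same_deck m G H ->
  \sum_(S : {set G} | #|S| == m) f (induced S)
    = \sum_(T : {set H} | #|T| == m) f (induced T).
Proof.
move=> f_inv GH.
have sumE (K : sgraph) : \sum_(S : {set K} | #|S| == m) f (induced S) =
    \sum_(a <- map (@induced K) [seq A : {set K} <- enum {: {set K}} | #|A| == m])
      f a.
  by rewrite big_map big_filter big_enum_cond.
rewrite !sumE; apply: (@eq_sum_of_eq_count _ gisob).
- exact: gisob_refl.
- exact: gisob_eq.
- by move=> K L /gisobP; apply: f_inv.
move=> K; have := GH K; rewrite /deck.
suff E (L : sgraph) : count (gisob^~ K)
      (map (@induced L) [seq A : {set L} <- enum {: {set L}} | #|A| == m])
    = #|[set S : {set L} | (#|S| == m) && gisob (induced S) K]|.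
  by rewrite -!E.
rewrite count_map count_filter -sum1_count big_enum_cond sum1dep_card.
by apply: eq_card => S; rewrite !inE andTb andbC.
Qed.

(** * Codegree sums and Kelly's counting *)

(* The pattern [(e, a)] selects the diagonal [(true, false)], the edges
   [(false, true)] or the non-edges [(false, false)]. *)
Definition codeg_sum (K : sgraph) (e a : bool) (Q : nat -> nat) : nat :=
  \sum_(x : K) \sum_(y : K | ((x == y) == e) && (adj x y == a))
    Q #|common_nbrs x y|.

Lemma giso_codeg (K L : sgraph) (f : K -> L) (x y : K) :
    bijective f -> {mono f : x y / adj x y} ->
  #|common_nbrs (f x) (f y)| = #|common_nbrs x y|.
Proof.
move=> f_bij f_mono; rewrite -(card_imset _ (bij_inj f_bij)).
apply: eq_card => z; have [g fK gK] := f_bij; rewrite -[z]gK.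
by rewrite (mem_imset _ _ (can_inj fK)) !inE !f_mono.
Qed.

Lemma giso_codeg_sum (K L : sgraph) e a Q :
  giso K L -> codeg_sum K e a Q = codeg_sum L e a Q.
Proof.
case=> f [f_bij f_mono]; rewrite /codeg_sum.
rewrite [RHS](reindex f (onW_bij _ f_bij)); apply: eq_bigr => x _.
rewrite [RHS](reindex f (onW_bij _ f_bij)); apply: eq_big => y.
  by rewrite f_mono (inj_eq (bij_inj f_bij)).
by move=> _; rewrite giso_codeg.
Qed.

Lemma induced_codeg (G : sgraph) (S : {set G}) (x y : induced S) :
  #|common_nbrs x y| = #|common_nbrs (val x) (val y) :&: S|.
Proof.
rewrite -(card_imset _ val_inj); apply: eq_card => z; rewrite inE.
apply/imsetP/andP => [[t + ->]|[+ zS]].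
  by rewrite !inE => ?; split=> //; apply: valP.
by rewrite !inE => xyz; exists (Sub z zS); rewrite ?inE.
Qed.

Lemma induced_codeg_binsum (G : sgraph) (S : {set G}) e a i :
  codeg_sum (induced S) e a (fun c => 'C(c, i)) =
  \sum_(x : G) \sum_(y : G | ((x == y) == e) && (adj x y == a))
    ([set x; y] \subset S) * 'C(#|common_nbrs x y :&: S|, i).
Proof.
rewrite /codeg_sum.
pose F x := \sum_(y in S | ((x == y) == e) && (adj x y == a))
    'C(#|common_nbrs x y :&: S|, i).
transitivity (\sum_(x in S) F x).
  rewrite [RHS]big_sub; apply: eq_bigr => x _; rewrite /F [RHS]big_sub_cond.
  by apply: eq_bigr => y _; rewrite induced_codeg.
rewrite big_mkcond; apply: eq_bigr => x _; rewrite /F.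
case: ifP => xS; last first.
  by rewrite big1 // => y _; rewrite subUset !sub1set xS.
rewrite big_mkcondl; apply: eq_bigr => y _; rewrite subUset !sub1set xS /=.
by case: ifP; rewrite ?mul1n.
Qed.

Lemma card_supersets (T : finType) (A : {set T}) (m : nat) : m <= #|T| ->
  #|[set S : {set T} | (#|S| == m) && (A \subset S)]| = 'C(#|T| - #|A|, #|T| - m).
Proof.
move=> le_m; have -> : #|T| - #|A| = #|~: A| by rewrite [RHS]cardsCs setCK.
rewrite -cards_draws -(card_imset _ (@setC_inj T)).
apply: eq_card => S; rewrite -[S]setCK (mem_imset _ _ (@setC_inj T)) !inE.
rewrite ?setCK andbC [A \subset _]subsetC.
by congr (_ && _); have := cardsC S; lia.
Qed.

(** Double counting of the pairs of a set [S] and an [i]-subset [A] of [M] with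
    [X :|: A \subset S]. *)
Lemma sum_supersets_bin (T : finType) (X M : {set T}) (m i : nat) :
    m <= #|T| -> [disjoint X & M] ->
  \sum_(S : {set T} | #|S| == m) (X \subset S) * 'C(#|M :&: S|, i)
    = 'C(#|M|, i) * 'C(#|T| - (#|X| + i), #|T| - m).
Proof.
move=> le_m XM.
pose D := [set A : {set T} | A \subset M & #|A| == i].
transitivity (\sum_(S : {set T} | #|S| == m) \sum_(A in D) (X :|: A \subset S)).
  apply: eq_bigr => S _; rewrite -cards_draws -sum1dep_card.
  rewrite big_distrr /= [RHS]big_mkcond [LHS]big_mkcond /=.
  apply: eq_bigr => A _; rewrite inE subUset subsetI.
  by case: (X \subset S); case: (A \subset M); case: (A \subset S); case: eqP.
rewrite exchange_big /= -(cards_draws M) -sum_nat_const.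
apply: eq_bigr => A; rewrite inE => /andP[AM /eqP <-].
have <- : #|X :|: A| = #|X| + #|A|.
  by rewrite cardsU disjoint_setI0 ?cards0 ?subn0 // (disjointWr AM).
rewrite -card_supersets // -sum1dep_card big_mkcondr /=.
by apply: eq_bigr => S _; case: (X :|: A \subset S).
Qed.

(* Kelly's counting argument: a configuration spanning [2 - e + i] vertices lies
   in a number of cards that depends only on its number of vertices. *)
Lemma sum_induced_codeg_binsum (G : sgraph) (m : nat) (e a : bool) (i : nat) :
    m <= #|G| ->
  \sum_(S : {set G} | #|S| == m) codeg_sum (induced S) e a (fun c => 'C(c, i))
    = codeg_sum G e a (fun c => 'C(c, i)) * 'C(#|G| - (2 - e + i), #|G| - m).
Proof.
move=> le_m; under eq_bigr => S _ do rewrite induced_codeg_binsum.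
rewrite exchange_big /codeg_sum big_distrl /=; apply: eq_bigr => x _.
rewrite exchange_big big_distrl /=; apply: eq_bigr => y /andP[/eqP <- _].
rewrite sum_supersets_bin //; last first.
  rewrite disjoint_sym disjoints_subset; apply/subsetP => z.
  rewrite !inE negb_or => /andP[xz yz].
  by rewrite (contraTneq _ xz) ?(contraTneq _ yz) // => ->; rewrite adj_irrefl.
by rewrite cards2; case: (x == y).
Qed.

Lemma same_deck_codeg_binsum (G H : sgraph) (m : nat) (e a : bool) (i : nat) :
    #|H| = #|G| -> m <= #|G| -> same_deck m G H -> 2 - e + i <= m ->
  codeg_sum G e a (fun c => 'C(c, i)) = codeg_sum H e a (fun c => 'C(c, i)).
Proof.
move=> cHG le_m GH le_im.
have := same_deck_sum (fun K L => @giso_codeg_sum K L e a (fun c => 'C(c, i))) GH.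
rewrite !sum_induced_codeg_binsum ?cHG // => /eqP; rewrite eqn_pmul2r => [/eqP //|].
(* [2 - e + i <= m] makes the number of cards through a configuration positive, so it can be
   cancelled. *)
rewrite bin_gt0; lia.
Qed.

Lemma same_deck_codeg_sum (G H : sgraph) (m : nat) (e a : bool) (d : nat)
    (q : nat -> nat) (Q : nat -> nat) :
    #|H| = #|G| -> m <= #|G| -> same_deck m G H -> 2 - e + d <= m ->
    (forall c, Q c = \sum_(i < d.+1) q i * 'C(c, i)) ->
  codeg_sum G e a Q = codeg_sum H e a Q.
Proof.
move=> cHG le_m GH le_dm QE.
have E K : codeg_sum K e a Q =
    \sum_(i < d.+1) q i * codeg_sum K e a (fun c => 'C(c, i)).
  rewrite /codeg_sum; under eq_bigr do under eq_bigr do rewrite QE.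
  under eq_bigr do rewrite exchange_big /=.
  rewrite exchange_big; apply: eq_bigr => i _; rewrite big_distrr.
  by apply: eq_bigr => x _; rewrite big_distrr.
rewrite !E; apply: eq_bigr => i _; congr (_ * _).
by apply: same_deck_codeg_binsum GH _ => //; have := ltn_ord i; lia.
Qed.

(** * Equality cases of inequalities between codegree sums *)

(** Stands in for the vanishing of a sum of nonnegative terms [Q2 - Q1]: subtraction on [nat]
    truncates, so negative terms go to [Q1] and positive ones to [Q2]. *)
Lemma codeg_sum_forall (K : sgraph) (e a : bool) (Q1 Q2 : nat -> nat)
    (C : pred nat) :
    (forall x y : K, (x == y) = e -> adj x y = a ->
       Q1 #|common_nbrs x y| <= Q2 #|common_nbrs x y| ?= iff C #|common_nbrs x y|) ->
  codeg_sum K e a Q1 = codeg_sum K e a Q2 <->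
  (forall x y : K, (x == y) = e -> adj x y = a -> C #|common_nbrs x y|).
Proof.
move=> Q12; rewrite /codeg_sum !pair_big_dep /=.
have := @leqif_sum _ (fun p : K * K => ((p.1 == p.2) == e) && (adj p.1 p.2 == a))
  (fun p => C #|common_nbrs p.1 p.2|) (fun p => Q1 #|common_nbrs p.1 p.2|)
  (fun p => Q2 #|common_nbrs p.1 p.2|).
case=> [[x y] /andP[/eqP xy /eqP axy]|_ E]; first exact: Q12.
split=> [/eqP|CK]; last first.
  by apply/eqP; rewrite E; apply/forall_inP => -[x y] /andP[/eqP ? /eqP ?]; apply: CK.
by rewrite E => /forall_inP CK x y xy axy; apply: (CK (x, y)); rewrite /= xy axy !eqxx.
Qed.

Lemma sqrn_bin c : c ^ 2 = c + 2 * 'C(c, 2).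
Proof. elim: c => // c IHc; rewrite binS bin1; nia. Qed.

Lemma cuben_bin c : c ^ 3 = c + 6 * 'C(c, 2) + 6 * 'C(c, 3).
Proof.
elim: c => // c IHc; rewrite !binS bin1.
by have := sqrn_bin c; have -> : c.+1 ^ 3 = c ^ 3 + 3 * c ^ 2 + 3 * c + 1; nia.
Qed.

Lemma same_deck_codeg_const (G H : sgraph) (m : nat) (e a : bool) (k : nat) :
    #|H| = #|G| -> m <= #|G| -> same_deck m G H -> 4 - e <= m ->
    (forall x y : G, (x == y) = e -> adj x y = a -> #|common_nbrs x y| = k) ->
  forall x y : H, (x == y) = e -> adj x y = a -> #|common_nbrs x y| = k.
Proof.
move=> cHG le_m GH le_em Gk x y xy axy; apply/eqP; move: x y xy axy.
have Q12 (K : sgraph) (x y : K) (_ : (x == y) = e) (_ : adj x y = a) :=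
  nat_Cauchy #|common_nbrs x y| k.
(* The two sides of [(c - k)^2 >= 0]; the quadratic one needs [2 - e + 2] vertices, whence
   [4 - e <= m]. *)
pose Q1 c := 2 * (c * k); pose Q2 c := c ^ 2 + k ^ 2.
apply/(codeg_sum_forall (Q1 := Q1) (Q2 := Q2) (C := pred1 k) (Q12 H)).
(* The lists hold coordinates in the basis ['C(c, 0)], ['C(c, 1)], ['C(c, 2)], where
   [c ^ 2 = c + 2 * 'C(c, 2)]. *)
rewrite -(same_deck_codeg_sum a (d := 1) (q := nth 0 [:: 0; 2 * k]) cHG le_m GH).
- rewrite -(same_deck_codeg_sum a (d := 2) (q := nth 0 [:: k ^ 2; 1; 2]) cHG le_m GH).
  + apply/(codeg_sum_forall (C := pred1 k) (Q12 G)) => x y xy axy.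
    by apply/eqP/Gk.
  + by case: (e) le_em; lia.
  + move=> c; rewrite /Q2 !big_ord_recr big_ord0 /= bin0 bin1.
    by rewrite sqrn_bin; lia.
- by case: (e) le_em; lia.
by move=> c; rewrite /Q1 !big_ord_recr big_ord0 /= bin1; lia.
Qed.

(** * Extending an isomorphism of cards *)

(** Replaces distance 2 by a condition on codegrees, which deck sums can detect: non-adjacent
    vertices at larger distance have codegree 0. *)
Definition codeg_regular (K : sgraph) (k l m : nat) : Prop :=
  [/\ forall x : K, #|common_nbrs x x| = k,
      forall x y : K, adj x y -> #|common_nbrs x y| = l
    & forall x y : K, x != y -> ~~ adj x y ->
        (#|common_nbrs x y| == 0) || (#|common_nbrs x y| == m)].

Lemma card_setIC2 (T : finType) (A : {set T}) (u v : T) : u != v ->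
  #|A| = #|A :&: ~: [set u; v]| + (u \in A) + (v \in A).
Proof.
move=> uv; rewrite (cardsD1 u) (cardsD1 v (A :\ u)) !inE eq_sym uv /=.
have -> : A :\ u :\ v = A :&: ~: [set u; v].
  apply/setP => z; rewrite !inE.
  by case: (z == u); case: (z == v); case: (z \in A).
lia.
Qed.

Lemma card_setC2 (T : finType) (u v : T) :
  u != v -> #|~: [set u; v]| + 2 = #|T|.
Proof. by move=> uv; rewrite -(cardsC [set u; v]) cards2 uv addnC. Qed.

Lemma codeg_split (K : sgraph) (p q a b : K) : p != q ->
  #|common_nbrs a b| =
  #|common_nbrs a b :&: ~: [set p; q]| + (adj a p && adj b p) + (adj a q && adj b q).
Proof. by move=> pq; rewrite (card_setIC2 _ pq) !inE. Qed.

Section CardIso.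
Variables (G H : sgraph) (x y : G) (u v : H) (g : H -> G).
Hypotheses (xy : x != y) (uv : u != v) (cHG : #|H| = #|G|).
Local Notation S := (~: [set x; y]).
Local Notation T := (~: [set u; v]).
Hypotheses (gS : {in T, forall h, g h \in S}) (g_inj : {in T &, injective g})
  (g_mono : {in T &, {mono g : a b / adj a b}}).

Lemma giso_extend :
    {in T, forall h, adj h u = adj (g h) x} ->
    {in T, forall h, adj h v = adj (g h) y} -> adj u v = adj x y ->
  giso H G.
Proof.
move=> gu gv uvxy.
pose f h := if h == u then x else if h == v then y else g h.
have inT h : h != u -> h != v -> h \in T by rewrite !inE negb_or => -> ->.
have inS h : h != u -> h != v -> (x != g h) && (y != g h).
  by move=> hu hv; have := gS (inT h hu hv); rewrite !inE negb_or ![_ == g h]eq_sym.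
exists f; split.
  apply: inj_card_bij; last by rewrite cHG.
  move=> a b; rewrite /f.
  case: (eqVneq a u) => [->|au]; case: (eqVneq b u) => [->|bu] //.
  - case: (eqVneq b v) => [_ /eqP|bv /eqP]; first by rewrite (negPf xy).
    by case/andP: (inS _ bu bv) => /negPf->.
  - case: (eqVneq a v) => [_ /eqP|av /eqP]; first by rewrite eq_sym (negPf xy).
    by case/andP: (inS _ au av); rewrite eq_sym => /negPf->.
  - case: (eqVneq a v) => [->|av]; case: (eqVneq b v) => [->|bv] //.
    + by move=> /eqP; case/andP: (inS _ bu bv) => _ /negPf->.
    + by move=> /eqP; case/andP: (inS _ au av) => _; rewrite eq_sym => /negPf->.
    + by apply: g_inj; apply: inT.
move=> a b; rewrite /f.
case: (eqVneq a u) => [->|au]; case: (eqVneq b u) => [->|bu].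
- by rewrite !adj_irrefl.
- case: (eqVneq b v) => [->|bv] //.
  by rewrite adj_sym -gu ?inT // adj_sym.
- case: (eqVneq a v) => [->|av]; first by rewrite adj_sym -uvxy adj_sym.
  by rewrite -gu ?inT.
- case: (eqVneq a v) => [->|av]; case: (eqVneq b v) => [->|bv].
  + by rewrite !adj_irrefl.
  + by rewrite adj_sym -gv ?inT // adj_sym.
  + by rewrite -gv ?inT.
  + by rewrite g_mono ?inT.
Qed.

Lemma card_iso_imset : g @: T = S.
Proof.
apply/eqP; rewrite eqEcard card_in_imset //; apply/andP; split.
  by apply/subsetP => _ /imsetP[h hT ->]; apply: gS.
by have := card_setC2 xy; have := card_setC2 uv; lia.
Qed.

Lemma card_iso_codeg : {in T &, forall a b,
  #|common_nbrs a b :&: T| = #|common_nbrs (g a) (g b) :&: S|}.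
Proof.
move=> a b aT bT; rewrite -(card_in_imset (f := g)); last first.
  by move=> c d /setIP[_ cT] /setIP[_ dT]; apply: g_inj.
apply: eq_card => z; apply/imsetP/setIP => [[c /setIP[]]|[]].
  rewrite inE => abc cT ->; split; last exact: gS.
  by rewrite inE !g_mono.
rewrite inE => abz; rewrite -card_iso_imset => /imsetP[c cT zc].
by exists c => //; rewrite inE cT andbT inE -!g_mono // -zc.
Qed.

Variables (k l m : nat).
Hypotheses (rG : codeg_regular G k l m) (rH : codeg_regular H k l m).

(** Both sides are [k] minus a degree inside the card, and [g] preserves the latter. *)
Lemma card_iso_degree : {in T, forall h,
  adj h u + adj h v = adj (g h) x + adj (g h) y}.
Proof.
case: rG rH => rG0 _ _ [rH0 _ _] h hT.
have := codeg_split h h uv; have := codeg_split (g h) (g h) xy.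
by rewrite rG0 rH0 !andbb card_iso_codeg //; lia.
Qed.

(** Summed over the card, the losses count the edges to the removed pair: [2 * k] minus twice its
    adjacency. *)
Lemma card_iso_adj : adj u v = adj x y.
Proof.
have nbrsE (K : sgraph) (p : K) (A : {set K}) :
    #|common_nbrs p p :&: A| = \sum_(z in A) adj z p.
  rewrite -sum1_card big_mkcond [RHS]big_mkcond; apply: eq_bigr => z _.
  by rewrite !inE andbb (adj_sym p); case: (z \in A); case: (adj z p).
have E : \sum_(h in T) (adj h u + adj h v) = \sum_(z in S) (adj z x + adj z y).
  by rewrite -card_iso_imset big_imset //; apply: eq_bigr => h; apply: card_iso_degree.
case: rG rH => rG0 _ _ [rH0 _ _]; move: E.
have := codeg_split u u uv; have := codeg_split v v uv.
have := codeg_split x x xy; have := codeg_split y y xy.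
rewrite !big_split /= -!nbrsE !rG0 !rH0 !andbb !adj_irrefl.
rewrite (adj_sym v u) (adj_sym y x); lia.
Qed.

Hypothesis m_ge2 : 2 <= m.

(* A common neighbour is lost from the card exactly when [a] and [b] hang on the
   same removed vertex; as [m >= 2], the codegree in the card reveals this. *)
Lemma card_iso_same_side : {in T &, forall a b,
    adj a u + adj a v = 1 -> adj b u + adj b v = 1 ->
  (adj a u == adj b u) = (adj (g a) x == adj (g b) x)}.
Proof.
move=> a b aT bT a1 b1; have := card_iso_degree aT; have := card_iso_degree bT.
rewrite a1 b1 => gb1 ga1.
have [->|ab] := eqVneq a b; first by rewrite !eqxx.
have gab : g a != g b by apply: contra_neq ab; apply: g_inj.
have := codeg_split a b uv; have := codeg_split (g a) (g b) xy.
rewrite -card_iso_codeg //; case: rG rH => _ rG1 rG2 [_ rH1 rH2].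
have [adj_ab|nadj_ab] := boolP (adj a b).
  rewrite rG1 ?g_mono // rH1 //.
  move: a1 b1 ga1 gb1; do 8!case: (adj _ _) => //=; lia.
have := rG2 _ _ gab; rewrite g_mono // => /(_ nadj_ab); have := rH2 _ _ ab nadj_ab.
move: a1 b1 ga1 gb1; do 8!case: (adj _ _) => //=; lia.
Qed.

End CardIso.

Lemma giso_of_card (G H : sgraph) (x y : G) (u v : H) (g : H -> G) (k l m : nat) :
    x != y -> u != v -> #|H| = #|G| ->
    {in ~: [set u; v], forall h, g h \in ~: [set x; y]} ->
    {in ~: [set u; v] &, injective g} ->
    {in ~: [set u; v] &, {mono g : a b / adj a b}} ->
    codeg_regular G k l m -> codeg_regular H k l m -> 2 <= m ->
  giso H G.
Proof.
move=> xy uv cHG gS g_inj g_mono rG rH m_ge2.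
(* If no vertex lost exactly one neighbour, every loss is 0 or 2 and [card_iso_degree] alone matches
   the neighbourhoods. *)
have [/forall_inP B0|] := boolP
  [forall h in ~: [set u; v], adj h u + adj h v != 1].
  have deg := card_iso_degree xy uv cHG gS g_inj g_mono rG rH.
  apply: (giso_extend xy cHG gS g_inj g_mono).
  - move=> h hT; have := B0 h hT; have := deg h hT.
    by do 4!case: (adj _ _).
  - move=> h hT; have := B0 h hT; have := deg h hT.
    by do 4!case: (adj _ _).
  - exact: (card_iso_adj xy uv cHG gS g_inj g_mono rG rH).
case/forall_inPn => h0 h0T; rewrite negbK => /eqP h01.
(* Exchanging [x] and [y] if necessary matches the side of [h0]; [card_iso_same_side] then aligns
   every other vertex with a single loss. *)
wlog h0x : x y xy gS / adj h0 u = adj (g h0) x.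
  move=> W; have [h0x|nh0x] := eqVneq (adj h0 u) (adj (g h0) x); first exact: (W x y).
  apply: (W y x); [by rewrite eq_sym | by rewrite (setUC [set y]) |].
  have := card_iso_degree xy uv cHG gS g_inj g_mono rG rH h0T.
  by move: nh0x h01; do 4!case: (adj _ _).
have deg := card_iso_degree xy uv cHG gS g_inj g_mono rG rH.
have side := card_iso_same_side xy uv cHG gS g_inj g_mono rG rH m_ge2.
have gu h : h \in ~: [set u; v] -> adj h u = adj (g h) x.
  move=> hT; have := deg h hT; have := side h0 h h0T hT h01; rewrite h0x.
  by do 5!case: (adj _ _) => //=; move=> /(_ erefl).
apply: (giso_extend xy cHG gS g_inj g_mono) => //.
  by move=> h hT; have := deg h hT; rewrite gu // => /addnI; do 2!case: (adj _ _).
exact: (card_iso_adj xy uv cHG gS g_inj g_mono rG rH).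
Qed.

(** * Transferring regularity to the other graph *)

Lemma common_nbrsxx (K : sgraph) (x : K) : common_nbrs x x = [set y | adj x y].
Proof. by apply/setP => y; rewrite !inE andbb. Qed.

(** Distinct non-adjacent vertices with a common neighbour are at distance 2. *)
Lemma weakly_distance_regular_codeg (G : sgraph) (k l m : nat) :
  weakly_distance_regular G k l m -> codeg_regular G k l m.
Proof.
case=> Gk Gl Gm; split=> // [x|x y xy nadj_xy]; first by rewrite common_nbrsxx.
rewrite cards_eq0; have [//|[z]] := set_0Vmem (common_nbrs x y).
  by move=> ->; rewrite eqxx.
rewrite inE => /andP[xz yz]; apply/orP; right; apply/eqP/Gm; split.
  by exists [:: z; y]; rewrite /= xz adj_sym yz.
case=> [|[|//]] [[|a [|b p]] [//= + Ey _]].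
  by move=> _; rewrite Ey eqxx in xy.
by rewrite andbT Ey (negPf nadj_xy).
Qed.

Lemma codeg_le_degree (K : sgraph) (x y : K) :
  #|common_nbrs x y| <= #|common_nbrs x x|.
Proof.
by apply/subset_leq_card/subsetP => z; rewrite !inE andbb => /andP[].
Qed.

(** Counts the walks of length two from [x], by midpoint on the right and by endpoint on the left:
    [x] itself, its neighbours, the other ends. *)
Lemma sum_codeg (K : sgraph) (k l m : nat) (x : K) : codeg_regular K k l m ->
  k + k * l + m * #|[set z | [&& x != z, ~~ adj x z & #|common_nbrs x z| != 0]]|
    = k * k.
Proof.
case=> K0 K1 K2; set B := [set z | _].
transitivity (\sum_z #|common_nbrs x z|); last first.
  transitivity (\sum_z \sum_(w in common_nbrs x x) (adj z w : nat)).
    apply: eq_bigr => z _; rewrite -sum1_card big_mkcond [RHS]big_mkcond.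
    by apply: eq_bigr => w _; rewrite !inE andbb; do 2!case: (adj _ w).
  rewrite exchange_big -{1}(K0 x) -sum_nat_const; apply: eq_bigr => w _.
  rewrite -(K0 w) -sum1_card [RHS]big_mkcond; apply: eq_bigr => z _.
  by rewrite !inE andbb adj_sym; case: (adj w z).
rewrite (bigD1 x) //= K0 -addnA; congr (_ + _).
rewrite (bigID (adj x)) /=; congr (_ + _).
  rewrite -(K0 x) -sum_nat_const [LHS]big_mkcond [RHS]big_mkcond.
  apply: eq_bigr => z _; rewrite inE andbb.
  by case: eqVneq => [->|_] /=; rewrite ?adj_irrefl //; case: ifP => // /K1.
rewrite mulnC -sum_nat_const [RHS]big_mkcond [LHS]big_mkcond.
apply: eq_bigr => z _; rewrite inE eq_sym; case: eqVneq => //= zx.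
case: (boolP (adj x z)) => //= nadj_xz; have := K2 x z _ nadj_xz.
rewrite eq_sym zx => /(_ isT); case: (eqVneq #|common_nbrs x z| 0) => [-> //|_] /=.
by move/eqP.
Qed.

Lemma codeg_six_vertices (K : sgraph) (k l m : nat) (x y : K) :
    codeg_regular K k l m -> 2 <= m -> #|K| = 6 -> x != y -> ~~ adj x y ->
    #|common_nbrs x y| != 0 -> m = k.
Proof.
move=> rK m_ge2 K6 xy nadj_xy c0; have := sum_codeg x rK.
set B := [set z | _] => E; case: (rK) => K0 _ K2.
have B_gt0 : 0 < #|B| by apply/card_gt0P; exists y; rewrite inE xy nadj_xy.
have le_mk : m <= k.
  have := K2 x y xy nadj_xy; rewrite (negPf c0) => /eqP <-.
  by rewrite -(K0 x) codeg_le_degree.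
have le_B : #|B| + k < 6.
  rewrite -K6 -(K0 x) -cardsUI.
  have -> : B :&: common_nbrs x x = set0.
    by apply/setP => z; rewrite !inE andbb; case: (adj x z); rewrite ?andbF.
  rewrite cards0 addn0 -cardsT; apply/proper_card/properP; split=> //.
  by exists x; rewrite ?inE // eqxx adj_irrefl.
(* [k] divides [m * b] with [0 < b], [b + k <= 5] and [2 <= m <= k]: so [m = 2] for [k = 2],
   [3 %| m] for [k = 3] and [4 %| m] for [k = 4]. *)
move: E B_gt0 le_B le_mk; move: #|B| => b {K0 K2 B rK}.
by case: k => [|[|[|[|[|k]]]]]; case: b => [|[|[|[|[|b]]]]]; lia.
Qed.

Lemma same_deck_codeg_regular (G H : sgraph) (k l m : nat) :
    6 <= #|G| -> #|H| = #|G| -> same_deck (#|G| - 2) G H -> 2 <= m ->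
  codeg_regular G k l m -> codeg_regular H k l m.
Proof.
move=> n_ge6 cHG GH m_ge2 rG; have [G0 G1 G2] := rG.
have le_n := leq_subr 2 #|G|.
have const e a c := @same_deck_codeg_const G H _ e a c cHG le_n GH.
have H0 (x : H) : #|common_nbrs x x| = k.
  apply: (const true false); rewrite ?eqxx ?adj_irrefl //; first lia.
  by move=> z _ /eqP<- _.
have H1 (x y : H) : adj x y -> #|common_nbrs x y| = l.
  move=> xy; apply: (const false true) => //; first lia.
    by move=> z t _ /G1.
  by apply: contraTF xy => /eqP->; rewrite adj_irrefl.
split=> // x y xy nadj_xy; apply/orP.
(* If every non-edge of [G] has codegree 0, the constant case applies with value 0; otherwise [a]
   and [b] serve [codeg_six_vertices] when [#|G| = 6]. *)
have [/existsP[a /existsP[b /and3P[ab nadj_ab c0]]]|nex] := boolP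
    [exists a : G, exists b, [&& a != b, ~~ adj a b & #|common_nbrs a b| != 0]];
  last first.
  left; apply/eqP/(const false false); rewrite ?(negPf xy) ?(negPf nadj_xy) //.
    lia.
  move=> a b ab nadj_ab; apply/eqP; apply: contraNT nex => c0.
  by apply/existsP; exists a; apply/existsP; exists b; rewrite ab nadj_ab.
apply/orP; pose C c := (c == 0) || (c == m).
have G2' (z t : G) : (z == t) = false -> adj z t = false -> C #|common_nbrs z t|.
  by move=> zt nadj_zt; apply: G2; rewrite ?zt ?nadj_zt.
apply: (_ : forall x y : H, (x == y) = false -> adj x y = false ->
  C #|common_nbrs x y|); rewrite ?(negPf xy) ?(negPf nadj_xy) // {x y xy nadj_xy}.
have transfer d q Q := @same_deck_codeg_sum G H _ false false d q Q cHG le_n GH.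
have [n_ge7|n_le6] := ltnP 6 #|G|.
  (* Negative and positive terms of [c * (c - m)^2]: a cubic, hence five vertices in a card and
     [7 <= #|G|]. *)
  pose Q1 c := c * (2 * (c * m)); pose Q2 c := c * (c ^ 2 + m ^ 2).
  have Q12 (K : sgraph) (x y : K) (_ : (x == y) = false) (_ : adj x y = false) :
      Q1 #|common_nbrs x y| <= Q2 #|common_nbrs x y| ?= iff C #|common_nbrs x y|.
    split; first by rewrite leq_mul2l nat_Cauchy orbT.
    by rewrite eqn_mul2l (nat_Cauchy _ _).2.
  apply/(codeg_sum_forall (Q12 H)).
  rewrite -(transfer 2 (nth 0 [:: 0; 2 * m; 4 * m])); last 1 first.
  - move=> c; rewrite /Q1 !big_ord_recr big_ord0 /= bin1.
    by have := sqrn_bin c; nia.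
  - by rewrite -(transfer 3 (nth 0 [:: 0; 1 + m ^ 2; 6; 6])); last 1 first;
      [move=> c; rewrite /Q2 !big_ord_recr big_ord0 /= bin1 mulnDr -expnS
         cuben_bin; lia | apply/(codeg_sum_forall (Q12 G)) | lia].
  - lia.
have mk : m = k by apply: (codeg_six_vertices rG _ _ ab) => //; lia.
(* Codegrees are at most [k = m], so [c * (m - c)] is nonnegative with zeros 0 and [m]; being
   quadratic, it fits in cards of four vertices. *)
pose Q1 c := c ^ 2; pose Q2 c := m * c.
have Q12 (K : sgraph) : (forall x : K, #|common_nbrs x x| = k) ->
    forall (x y : K) (_ : (x == y) = false) (_ : adj x y = false),
    Q1 #|common_nbrs x y| <= Q2 #|common_nbrs x y| ?= iff C #|common_nbrs x y|.
  move=> K0 x y _ _; have := codeg_le_degree x y; rewrite K0 -mk /Q1 /Q2 /C.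
  by move: #|_| => c le_cm; split; nia.
apply/(codeg_sum_forall (Q12 H H0)).
rewrite -(transfer 2 (nth 0 [:: 0; 1; 2])); last 1 first.
- by move=> c; rewrite /Q1 !big_ord_recr big_ord0 /= bin1 sqrn_bin; lia.
- by rewrite -(transfer 1 (nth 0 [:: 0; m])); last 1 first;
    [move=> c; rewrite /Q2 !big_ord_recr big_ord0 /= bin1
    | apply/(codeg_sum_forall (Q12 G G0)) | lia].
- lia.
Qed.

(** * Matching one card of each graph *)

Theorem theorem3 (G : sgraph) (k lambda mu' : nat)
  (hn : 6 <= #|G|)
  (hG : weakly_distance_regular G k lambda mu')
  (hmu : 2 <= mu') :
  reconstructible 2 G.
Proof.
move=> H cHG GH; have rG := weakly_distance_regular_codeg hG.
have rH := same_deck_codeg_regular hn cHG GH hmu rG.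
have [x [y xy]] : exists x y : G, x != y.
  have /card_gt1P[x [y [_ _ xy]]] : 1 < #|G| by lia.
  by exists x, y.
have : 0 < deck H (#|G| - 2) (induced (~: [set x; y])).
  rewrite -GH; apply/card_gt0P; exists (~: [set x; y]).
  by rewrite inE gisob_refl andbT -(card_setC2 xy) addnK.
case/card_gt0P => T; rewrite inE => /andP[/eqP cT /gisobP[f [f_bij f_mono]]].
have /cards2P[u [v [uv Tuv]]] : #|~: T| == 2.
  by have := cardsC T; rewrite cT; lia.
have {Tuv} ET : T = ~: [set u; v] by rewrite -Tuv setCK.
(* [x] is a mere default: [g] matters only on the card, where it is [f]. *)
subst T; pose g h := if insub h is Some s then val (f s) else x.
have gE h (hT : h \in ~: [set u; v]) : g h = val (f (Sub h hT)).
  by rewrite /g insubT.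
apply: (giso_of_card xy uv cHG _ _ _ rG rH hmu (g := g)).
- by move=> h hT; rewrite gE; apply: valP.
- move=> a b aT bT; rewrite !gE => /val_inj /(bij_inj f_bij).
  by move/(congr1 val).
- by move=> a b aT bT; rewrite !gE; apply: f_mono.
Qed.
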